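(* Let $n\ge 2$. The assignment $\sigma_i^{\pm1}\mapsto\sigma_i^{\pm1}$, $b_i\mapsto p_i$ ($1\le i\le n-1$) on the elementary braidings and tight bonds, where $p_i=\sigma_i^2$, defines a homomorphism of monoids $\Phi\colon BB_n\to B_n$. This homomorphism is surjective but not injective.
   Context: $B_n$ is the Artin braid group with generators $\sigma_1,\dots,\sigma_{n-1}$ and relations $\sigma_i\sigma_j=\sigma_j\sigma_i$ for $|i-j|>1$ and $\sigma_i\sigma_{i+1}\sigma_i=\sigma_{i+1}\sigma_i\sigma_{i+1}$ for $1\le i\le n-2$. Here the bonded braid monoid $BB_n$ is taken in its tight presentation: it is the monoid generated by $\sigma_i,\sigma_i^{-1}$ and the tight bonds $b_i$, $1\le i\le n-1$, with relations $\sigma_i\sigma_i^{-1}=\sigma_i^{-1}\sigma_i=1$ and: 1) $\sigma_i\sigma_j=\sigma_j\sigma_i$ for $|i-j|>1$; 2) $\sigma_i\sigma_{i+1}\sigma_i=\sigma_{i+1}\sigma_i\sigma_{i+1}$ for $1\le i\le n-2$; 3) $b_ib_j=b_jb_i$ for $|i-j|>1$; 4) $b_i\sigma_j^{\pm1}=\sigma_j^{\pm1}b_i$ for $|i-j|>1$; 5) $b_i\sigma_i^{\pm1}=\sigma_i^{\pm1}b_i$ for $1\le i\le n-1$; 6) $b_i\sigma_{i+1}\sigma_i=\sigma_{i+1}\sigma_ib_{i+1}$ for $1\le i\le n-2$; 7) $\sigma_i\sigma_{i+1}b_i=b_{i+1}\sigma_i\sigma_{i+1}$ for $1\le i\le n-2$.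 *)

(* Defs.v *)
From HB Require Import structures.
From mathcomp Require Import all_boot boolp.

Set Implicit Arguments.
Unset Strict Implicit.
Unset Printing Implicit Defensive.

Local Open Scope group_scope.
Local Open Scope quotient_scope.

Section Presentation.
Variables (A : choiceType) (R : seq A -> seq A -> Prop).

(* The smallest congruence on the free monoid [seq A] that contains [R]. *)
Inductive cong : seq A -> seq A -> Prop :=
| cong_rel u v l r : R l r -> cong (u ++ l ++ v) (u ++ r ++ v)
| cong_refl w : cong w w
| cong_sym w1 w2 : cong w1 w2 -> cong w2 w1
| cong_trans w1 w2 w3 : cong w1 w2 -> cong w2 w3 -> cong w1 w3.

Lemma cong_ctx u v w1 w2 : cong w1 w2 -> cong (u ++ w1 ++ v) (u ++ w2 ++ v).
Proof.
elim=> [a b l r Rlr|w|w w' _|x y z _ IHxy _ IHyz].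
- have := @cong_rel (u ++ a) (b ++ v) l r Rlr; by rewrite -!catA.
- exact: cong_refl.
- exact: cong_sym.
- exact: cong_trans IHxy IHyz.
Qed.

Lemma cong_cat w1 w2 w1' w2' :
  cong w1 w1' -> cong w2 w2' -> cong (w1 ++ w2) (w1' ++ w2').
Proof.
move=> c1 c2; apply: (@cong_trans _ (w1' ++ w2)); first exact: (cong_ctx [::]).
by have := cong_ctx w1' [::] c2; rewrite !cats0.
Qed.

Definition congb : rel (seq A) := fun w1 w2 => `[< cong w1 w2 >].

Lemma congb_refl : reflexive congb.
Proof. by move=> w; apply/asboolP/cong_refl. Qed.

Lemma congb_sym : symmetric congb.
Proof. by move=> w1 w2; apply/asboolP/asboolP; apply: cong_sym. Qed.

Lemma congb_trans : transitive congb.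
Proof.
move=> w2 w1 w3 /asboolP c12 /asboolP c23; apply/asboolP.
exact: cong_trans c12 c23.
Qed.

Canonical congb_equiv := EquivRel congb congb_refl congb_sym congb_trans.

Definition presented := {eq_quot congb}.

HB.instance Definition _ := Choice.on presented.

Definition class (w : seq A) : presented := \pi w.

Definition gen (a : A) : presented := class [:: a].

Lemma class_eqP w1 w2 : class w1 = class w2 <-> cong w1 w2.
Proof.
by split=> [/eqmodP/asboolP|c] //; apply/eqmodP/asboolP.
Qed.

Lemma class_ind (P : presented -> Prop) :
  (forall w, P (class w)) -> forall x, P x.
Proof. by move=> Pw x; rewrite -[x]reprK; apply: Pw. Qed.

Lemma cong_repr w : cong (repr (class w)) w.
Proof. by apply/class_eqP; rewrite /class reprK. Qed.

Definition presented_one : presented := class [::].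

Definition presented_mul (x y : presented) : presented :=
  class (repr x ++ repr y).

Lemma class_mul w1 w2 : presented_mul (class w1) (class w2) = class (w1 ++ w2).
Proof. by apply/class_eqP/cong_cat; apply: cong_repr. Qed.

Lemma presented_mulA : associative presented_mul.
Proof.
elim/class_ind=> x; elim/class_ind=> y; elim/class_ind=> z.
by rewrite !class_mul catA.
Qed.

Lemma presented_1mul : left_id presented_one presented_mul.
Proof. by elim/class_ind=> x; rewrite class_mul. Qed.

Lemma presented_mul1 : right_id presented_one presented_mul.
Proof. by elim/class_ind=> x; rewrite class_mul cats0. Qed.

HB.instance Definition _ :=
  isMonoid.Build presented presented_mulA presented_1mul presented_mul1.

End Presentation.

(* Indices start from 0: [i : 'I_n.-1] stands for the index i + 1 in the usual
   numbering 1, ..., n - 1 of the generators. *)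
Definition far (i j : nat) : bool := (i.+1 < j) || (j.+1 < i).

Inductive braid_letter (n : nat) : Type :=
| Sigma of 'I_n.-1
| SigmaV of 'I_n.-1.

HB.instance Definition _ n := gen_eqMixin (braid_letter n).
HB.instance Definition _ n := gen_choiceMixin (braid_letter n).

Inductive braid_rel (n : nat) :
  seq (braid_letter n) -> seq (braid_letter n) -> Prop :=
| braid_sV (i : 'I_n.-1) : braid_rel [:: Sigma i; SigmaV i] [::]
| braid_Vs (i : 'I_n.-1) : braid_rel [:: SigmaV i; Sigma i] [::]
| braid_comm (i j : 'I_n.-1) : far i j ->
    braid_rel [:: Sigma i; Sigma j] [:: Sigma j; Sigma i]
| braid_braid (i j : 'I_n.-1) : j = i.+1 :> nat ->
    braid_rel [:: Sigma i; Sigma j; Sigma i] [:: Sigma j; Sigma i; Sigma j].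

(* The group presentation of B_n, written as a monoid presentation with formal
   inverse letters; the group structure is built below. *)
Definition braid (n : nat) := presented (@braid_rel n).

HB.instance Definition _ n := Monoid.on (braid n).

Definition inv_letter n (a : braid_letter n) : braid_letter n :=
  match a with Sigma i => SigmaV i | SigmaV i => Sigma i end.

Definition inv_word n (w : seq (braid_letter n)) : seq (braid_letter n) :=
  rev (map (@inv_letter n) w).

Definition braid_inv n (x : braid n) : braid n := class _ (inv_word (repr x)).

Lemma cong_inv_word n (w : seq (braid_letter n)) :
  cong (@braid_rel n) (inv_word w ++ w) [::].
Proof.
elim: w => [|a w IHw]; first exact: cong_refl.
apply: cong_trans IHw.
rewrite /inv_word /= rev_cons cat_rcons.
by apply: (@cong_rel _ _ _ w [:: inv_letter a; a] [::]); case: a => i; constructor.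
Qed.

Lemma inv_wordK n : involutive (@inv_word n).
Proof.
move=> w; rewrite /inv_word map_rev revK -map_comp map_id_in //.
by case.
Qed.

Lemma braid_mulVg n : left_inverse (1 : braid n) (@braid_inv n) *%g.
Proof.
move=> x; rewrite -{2}[x]reprK.
apply: etrans (class_mul _ _ _) _; apply/class_eqP.
exact: cong_inv_word.
Qed.

Lemma braid_mulgV n : right_inverse (1 : braid n) (@braid_inv n) *%g.
Proof.
move=> x; rewrite -{1}[x]reprK.
apply: etrans (class_mul _ _ _) _; apply/class_eqP.
rewrite -{1}[repr x]inv_wordK; exact: cong_inv_word.
Qed.

HB.instance Definition _ n := hasInv.Build (braid n) (@braid_inv n).
HB.instance Definition _ n :=
  Monoid_isGroup.Build (braid n) (@braid_mulVg n) (@braid_mulgV n).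

Definition sigma n (i : 'I_n.-1) : braid n := gen _ (Sigma i).

Inductive bonded_letter (n : nat) : Type :=
| BSigma of 'I_n.-1
| BSigmaV of 'I_n.-1
| Bond of 'I_n.-1.

HB.instance Definition _ n := gen_eqMixin (bonded_letter n).
HB.instance Definition _ n := gen_choiceMixin (bonded_letter n).

Inductive bonded_rel (n : nat) :
  seq (bonded_letter n) -> seq (bonded_letter n) -> Prop :=
| bonded_sV (i : 'I_n.-1) : bonded_rel [:: BSigma i; BSigmaV i] [::]
| bonded_Vs (i : 'I_n.-1) : bonded_rel [:: BSigmaV i; BSigma i] [::]
| bonded_ss_comm (i j : 'I_n.-1) : far i j ->
    bonded_rel [:: BSigma i; BSigma j] [:: BSigma j; BSigma i]
| bonded_braid (i j : 'I_n.-1) : j = i.+1 :> nat ->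
    bonded_rel [:: BSigma i; BSigma j; BSigma i]
               [:: BSigma j; BSigma i; BSigma j]
| bonded_bb_comm (i j : 'I_n.-1) : far i j ->
    bonded_rel [:: Bond i; Bond j] [:: Bond j; Bond i]
| bonded_bs_comm (i j : 'I_n.-1) : far i j ->
    bonded_rel [:: Bond i; BSigma j] [:: BSigma j; Bond i]
| bonded_bV_comm (i j : 'I_n.-1) : far i j ->
    bonded_rel [:: Bond i; BSigmaV j] [:: BSigmaV j; Bond i]
| bonded_bs (i : 'I_n.-1) : bonded_rel [:: Bond i; BSigma i] [:: BSigma i; Bond i]
| bonded_bV (i : 'I_n.-1) : bonded_rel [:: Bond i; BSigmaV i] [:: BSigmaV i; Bond i]
| bonded_slide_l (i j : 'I_n.-1) : j = i.+1 :> nat ->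
    bonded_rel [:: Bond i; BSigma j; BSigma i]
               [:: BSigma j; BSigma i; Bond j]
| bonded_slide_r (i j : 'I_n.-1) : j = i.+1 :> nat ->
    bonded_rel [:: BSigma i; BSigma j; Bond i]
               [:: Bond j; BSigma i; BSigma j].

Definition bonded_braid_monoid (n : nat) := presented (@bonded_rel n).

HB.instance Definition _ n := Monoid.on (bonded_braid_monoid n).

Definition bsigma n (i : 'I_n.-1) : bonded_braid_monoid n := gen _ (BSigma i).
Definition bsigmaV n (i : 'I_n.-1) : bonded_braid_monoid n := gen _ (BSigmaV i).
Definition bond n (i : 'I_n.-1) : bonded_braid_monoid n := gen _ (Bond i).

Definition pure_gen n (i : 'I_n.-1) : braid n := sigma i ^+ 2.

Definition extends_assignment n (f : bonded_braid_monoid n -> braid n) : Prop :=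
  [/\ forall i, f (bsigma i) = sigma i,
      forall i, f (bsigmaV i) = (sigma i)^-1
    & forall i, f (bond i) = pure_gen i].

(* Main.v *)
(* The map Phi exists because the relations of BB_n hold in B_n once b_i is read
   as sigma_i^2. It is surjective since every word in the letters sigma_i^{+-1}
   is also a word of BB_n. It is not injective because every relation of BB_n
   has as many bonds on both sides: the number of bonds is an invariant of BB_n,
   which separates b_i from sigma_i^2 although Phi identifies them. *)
Require Import Defs.
From HB Require Import structures.
From mathcomp Require Import all_boot.

Set Implicit Arguments.
Unset Strict Implicit.
Unset Printing Implicit Defensive.

Local Open Scope group_scope.

(** Iterated products turn concatenation into [op], so invariance under [R] passes to any context
    and then through the closure. It serves for products in a monoid and for counting letters with
    addition. *)
Lemma cong_big (A : choiceType) (R : seq A -> seq A -> Prop)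
    (T : Type) (idx : T) (op : Monoid.law idx) (f : A -> T) :
  (forall l r, R l r -> \big[op/idx]_(a <- l) f a = \big[op/idx]_(a <- r) f a) ->
  forall w1 w2, cong R w1 w2 ->
    \big[op/idx]_(a <- w1) f a = \big[op/idx]_(a <- w2) f a.
Proof.
move=> fR w1 w2; elim=> {w1 w2} [u v l r Rlr|//|w1 w2 _ ->//|w1 w2 w3 _ -> _ ->//].
by rewrite !big_cat (fR _ _ Rlr).
Qed.

Lemma class_mulg (A : choiceType) (R : seq A -> seq A -> Prop) (u v : seq A) :
  class R u * class R v = class R (u ++ v).
Proof. exact: class_mul. Qed.

Lemma class_prod (A : choiceType) (R : seq A -> seq A -> Prop) (w : seq A) :
  class R w = \prod_(a <- w) gen R a.
Proof.
elim: w => [|a w IHw]; first by rewrite big_nil.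
by rewrite big_cons -IHw class_mulg.
Qed.

Lemma gen_prod_rel (A : choiceType) (R : seq A -> seq A -> Prop) (l r : seq A) :
  R l r -> \prod_(a <- l) gen R a = \prod_(a <- r) gen R a.
Proof.
move=> /(cong_rel [::] [::]); rewrite /= !cats0 -!class_prod.
by move/class_eqP.
Qed.

Section Lift.
Variables (A : choiceType) (R : seq A -> seq A -> Prop) (M : monoidType).
Variable f : A -> M.
Hypothesis fR :
  forall l r, R l r -> \prod_(a <- l) f a = \prod_(a <- r) f a.

(** The universal map out of a presented monoid, evaluated on a chosen representative; [fR] makes
    the choice harmless. *)
Definition presented_lift (x : presented R) : M := \prod_(a <- repr x) f a.

Lemma presented_lift_class w : presented_lift (class R w) = \prod_(a <- w) f a.
Proof. exact: cong_big fR _ _ (cong_repr R w). Qed.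

Lemma presented_lift_gen a : presented_lift (gen R a) = f a.
Proof. by rewrite presented_lift_class big_seq1. Qed.

Lemma presented_lift_monoid_morphism : monoid_morphism presented_lift.
Proof.
split=> [|x y]; first by rewrite presented_lift_class big_nil.
elim/class_ind: x => u; elim/class_ind: y => v.
by rewrite class_mulg !presented_lift_class big_cat.
Qed.

Definition presented_lift_morphism : UMagmaMorphism.type (presented R) M :=
  HB.pack presented_lift (isUMagmaMorphism.Build _ _ presented_lift presented_lift_monoid_morphism).

End Lift.

Section Braid.
Variable n : nat.
Implicit Types i j : 'I_n.-1.

Lemma sigma_commute i j : far i j -> commute (sigma i) (sigma j).
Proof.
by move/braid_comm/gen_prod_rel; rewrite !big_cons big_nil !mulg1.
Qed.

Lemma sigma_braid i j : j = i.+1 :> nat ->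
  sigma i * sigma j * sigma i = sigma j * sigma i * sigma j.
Proof.
by move/braid_braid/gen_prod_rel; rewrite !big_cons big_nil !mulg1 !mulgA.
Qed.

(** [SigmaV i] is only a formal letter; the relation [braid_sV] and uniqueness of inverses identify
    it with the group inverse. *)
Lemma sigmaV_gen i : gen (@braid_rel n) (SigmaV i) = (sigma i)^-1 :> braid n.
Proof.
apply/esym/mulg1_eq.
by have := gen_prod_rel (braid_sV i); rewrite !big_cons !big_nil !mulg1.
Qed.

Definition bonded_value (a : bonded_letter n) : braid n :=
  match a with
  | BSigma i => sigma i
  | BSigmaV i => (sigma i)^-1
  | Bond i => pure_gen i
  end.

(** Commutations involving bonds hold because powers of commuting elements commute; each slide
    relation takes two uses of the braid relation. *)
Lemma bonded_value_rel l r : bonded_rel l r ->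
  \prod_(a <- l) bonded_value a = \prod_(a <- r) bonded_value a.
Proof.
have farP i j : far i j -> commute (pure_gen i) (sigma j).
  by move=> /sigma_commute ij; apply/commute_sym/commuteX/commute_sym.
have selfP i : commute (pure_gen i) (sigma i).
  exact/commute_sym/commuteX/commute_refl.
case=> [i|i|i j ij|i j ij|i j ij|i j ij|i j ij|i|i|i j ij|i j ij];
  rewrite !big_cons big_nil ?mulg1 ?big_nil /=.
- exact: mulgV.
- exact: mulVg.
- exact: sigma_commute.
- by rewrite !mulgA sigma_braid.
- exact/commuteX2/sigma_commute.
- exact: farP.
- exact/commuteV/farP.
- exact: selfP.
- exact/commuteV/selfP.
(* A braid move on the right side exposes a common left factor [sigma i]; the remainder is the braid
   relation itself. *)
- rewrite /pure_gen !expg2 !mulgA -(sigma_braid ij) -!mulgA.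
  by congr (_ * _); rewrite !mulgA sigma_braid.
(* Here the move is made on the left side, and the common left factor is [sigma j]. *)
- rewrite /pure_gen !expg2 !mulgA (sigma_braid ij) -!mulgA.
  by congr (_ * _); rewrite !mulgA sigma_braid.
Qed.

Definition bonded_to_braid :
    UMagmaMorphism.type (bonded_braid_monoid n) (braid n) :=
  presented_lift_morphism bonded_value_rel.

Lemma bonded_to_braid_extends : extends_assignment bonded_to_braid.
Proof. by split=> i; apply: (presented_lift_gen bonded_value_rel). Qed.

(** A morphism is determined by its values on generators, which yields the uniqueness of Phi. *)
Lemma extends_assignment_class
    (Psi : UMagmaMorphism.type (bonded_braid_monoid n) (braid n)) w :
  extends_assignment Psi ->
  Psi (class _ w) = \prod_(a <- w) bonded_value a.
Proof.
case=> Psi_s Psi_V Psi_b.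
rewrite class_prod gmulf_prod; apply: eq_bigr => -[] i _;
  [exact: Psi_s | exact: Psi_V | exact: Psi_b].
Qed.

Definition bonded_of_braid_letter (a : braid_letter n) : bonded_letter n :=
  match a with Sigma i => BSigma i | SigmaV i => BSigmaV i end.

Lemma bonded_to_braid_surj (y : braid n) : exists x, bonded_to_braid x = y.
Proof.
elim/class_ind: y => w; exists (class _ (map bonded_of_braid_letter w)).
rewrite (extends_assignment_class _ bonded_to_braid_extends) class_prod big_map.
by apply: eq_bigr => -[] i _ //=; rewrite sigmaV_gen.
Qed.

Definition is_bond (a : bonded_letter n) : bool :=
  if a is Bond _ then true else false.

Lemma class_count_bond w1 w2 :
  class (@bonded_rel n) w1 = class _ w2 -> count is_bond w1 = count is_bond w2.
Proof.
(* The count becomes a sum of indicators, so that [cong_big] applies in the additive monoid of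
   naturals. *)
move/class_eqP => w12; rewrite -!sumn_count !sumnE !big_map.
by apply: cong_big w12 => l r; case=> *; rewrite !big_cons !big_nil.
Qed.

Lemma bond_neq_bsigma_sq i : bond i <> bsigma i * bsigma i.
(* The bond counts would give 1 = 0. *)
Proof. by rewrite class_mulg => /class_count_bond. Qed.

End Braid.

Theorem theorem7p1 (n : nat) (hn : (2 <= n)%N) :
  exists Phi : UMagmaMorphism.type (bonded_braid_monoid n) (braid n),
    [/\ extends_assignment Phi,
        forall Psi : UMagmaMorphism.type (bonded_braid_monoid n) (braid n),
          extends_assignment Psi -> Psi =1 Phi,
        forall y : braid n, exists x : bonded_braid_monoid n, Phi x = y
      & ~ injective Phi].
Proof.
exists (bonded_to_braid n); have Phi_ext := bonded_to_braid_extends n.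
split=> // [Psi Psi_ext x||].
- by elim/class_ind: x => w; rewrite !extends_assignment_class.
- exact: bonded_to_braid_surj.
(* By [hn] there is at least one generator index, namely 0. *)
- have i : 'I_n.-1 by apply: (@Ordinal _ 0); rewrite -subn1 subn_gt0.
  move=> Phi_inj; apply: (@bond_neq_bsigma_sq _ i); apply: Phi_inj.
  by have [Phi_s _ Phi_b] := Phi_ext; rewrite gmulfM Phi_s Phi_b.
Qed.
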